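(* Let $(X,T)$ be a topological dynamical system and let $A=(a_{ij})_{1\le i,j\le p}$ be an irreducible transition matrix, $p\ge 2$, which has a row whose row sum is at least $2$ (i.e. $\sum_{j=1}^p a_{i_0j}\ge 2$ for some $i_0$). If $T$ is strictly $A$-coupled-expanding in some subsets $\Lambda_1,\dots,\Lambda_p\subset X$, then $h_{top}(X,T)\ge \frac{\log 2}{p}$ and $(X,T)$ is chaotic in the sense of Li-Yorke.
   Context: A topological dynamical system $(X,T)$ is a compact metric space $X$ with metric $d$ together with a surjective continuous map $T:X\to X$; $h_{top}(X,T)$ is its topological entropy (defined via finite open covers). A $p\times p$ matrix $A=(a_{ij})$ is a transition matrix if all $a_{ij}\in\{0,1\}$ and every row sum and every column sum is at least $1$. $A$ is irreducible if for each pair $(i,j)$ there is a positive integer $k$ with $(A^k)_{ij}>0$. For $p\ge2$, $T$ is $A$-coupled-expanding in nonempty subsets $\Lambda_1,\dots,\Lambda_p$ of $X$ with pairwise disjoint interiors if $T(\Lambda_i)\supset\bigcup_{j:\,a_{ij}=1}\Lambda_j$ for all $1\le i\le p$; it is strictly $A$-coupled-expanding if moreover $d(\Lambda_i,\Lambda_j)=\inf\{d(x,y):x\in\Lambda_i,y\in\Lambda_j\}>0$ for all $i\ne j$. A set $S\subset X$ is scrambled if for any two distinct $x,y\in S$, $\liminf_{n\to\infty}d(T^n(x),T^n(y))=0$ and $\limsup_{n\to\infty}d(T^n(x),T^n(y))>0$. $(X,T)$ is chaotic in the sense of Li-Yorke if it has an uncountable scrambled set. *)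

(* Defs.v *)
(* MathComp-Analysis. *)
From HB Require Import structures.
From mathcomp Require Import all_boot all_order all_algebra.
From mathcomp Require Import all_classical all_reals all_analysis.

Set Implicit Arguments.
Unset Strict Implicit.
Unset Printing Implicit Defensive.

Import Order.TTheory GRing.Theory Num.Theory.
Import numFieldNormedType.Exports.

Local Open Scope classical_set_scope.
Local Open Scope ring_scope.

Definition dynamical_system (R : realType) (X : metricType R) (T : X -> X) : Prop :=
  [/\ compact [set: X], continuous T & range T = [set: X]].

Definition open_cover (X : topologicalType) (U : set (set X)) : Prop :=
  (forall A, U A -> open A) /\ cover U id = [set: X].

Definition cover_join (X : Type) (U V : set (set X)) : set (set X) :=
  [set A `&` B | A in U & B in V].

(* U \/ T^-1 U \/ ... \/ T^-(n-1) U *)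
Definition iterated_join (X : Type) (T : X -> X) (U : set (set X)) (n : nat)
    : set (set X) :=
  \big[@cover_join X/[set [set: X]]]_(k < n) (preimage (iter k T) @` U).

(* Minimal cardinality of a subcover, as a real number: when U has a finite
   subcover, the infimum is that of a nonempty set of naturals, hence attained. *)
Definition covering_number (R : realType) (X : Type) (U : set (set X)) : R :=
  inf [set (k%:R : R) | k in [set k : nat | exists V : set (set X),
    [/\ V `<=` U, cover V id = [set: X] & (V #= `I_k)%card]]].

(* For X nonempty and compact, T continuous and U an open cover, the sequence
   n |-> ln (N (iterated_join T U n)) is subadditive, so the limit exists. *)
Definition cover_entropy (R : realType) (X : Type) (T : X -> X)
    (U : set (set X)) : R :=
  limn (fun n : nat => ln (covering_number R (iterated_join T U n)) / n%:R : R).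

Definition topological_entropy (R : realType) (X : metricType R) (T : X -> X)
    : \bar R :=
  ereal_sup [set (cover_entropy R T U)%:E |
             U in [set U : set (set X) | finite_set U /\ open_cover U]].

Definition transition_matrix (p : nat) (A : 'M[nat]_p) : Prop :=
  [/\ forall i j, A i j = 0%N \/ A i j = 1%N,
      forall i, (1 <= \sum_j A i j)%N &
      forall j, (1 <= \sum_i A i j)%N].

Definition irreducible_mx (p : nat) (A : 'M[nat]_p) : Prop :=
  forall i j, exists2 k : nat, (0 < k)%N & (0 < (A ^+ k) i j)%N.

Definition coupled_expanding (R : realType) (X : metricType R) (T : X -> X)
    (p : nat) (A : 'M[nat]_p) (L : 'I_p -> set X) : Prop :=
  [/\ forall i, L i !=set0,
      forall i j, i != j -> (L i)° `&` (L j)° = set0 &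
      forall i, \bigcup_(j in [set j | A i j = 1%N]) L j `<=` T @` L i].

(* Used only between nonempty sets, where the infimum is genuine. *)
Definition set_dist (R : realType) (X : metricType R) (B C : set X) : R :=
  inf [set mdist x y | x in B & y in C].

Definition strictly_coupled_expanding (R : realType) (X : metricType R)
    (T : X -> X) (p : nat) (A : 'M[nat]_p) (L : 'I_p -> set X) : Prop :=
  coupled_expanding T A L /\
  forall i j, i != j -> 0 < set_dist (L i) (L j).

Definition scrambled (R : realType) (X : metricType R) (T : X -> X)
    (S : set X) : Prop :=
  forall x y, S x -> S y -> x <> y ->
    (limn_einf (fun n => (mdist (iter n T x) (iter n T y))%:E) = 0)%E /\
    (0 < limn_esup (fun n => (mdist (iter n T x) (iter n T y))%:E))%E.

Definition li_yorke_chaotic (R : realType) (X : metricType R) (T : X -> X)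
    : Prop :=
  exists S : set X, ~ countable S /\ scrambled T S.

(* Main.v *)
Require Import Defs.
From HB Require Import structures.
From mathcomp Require Import all_boot all_order all_algebra.
From mathcomp Require Import all_classical all_reals all_analysis.
From mathcomp Require Import zify lra.

(** Entropy.  Let [U i] be the complement of the closure of the union of the
[L l] with [l != i].  Positive distances make the [U i] an open cover in which
[U i] is disjoint from every other [L l].  Each path of the transition graph is
the itinerary of a point through the [L i] ([exists_itinerary]), and an element
of the [n]-th iterated join of this cover contains points with the itinerary of one path only,
so a subcover has at least as many elements as there are paths with [n]
vertices starting at a vertex [i0] with two successors
([card_paths_le_cover]).  From [i0] two distinct loops of length at most [p] are
available, whence at least [2 ^ q] such paths when [n = p * q]
([card_paths_ge]).  Covering numbers of iterated joins are submultiplicative, so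
the limit defining the entropy of the cover exists ([fekete_subadditive]) and is
at least [ln 2 / p].

Li-Yorke chaos.  Two points with the same itinerary need not come close, since
the [L i] may have large diameter and the set of points with a given itinerary
may carry distal dynamics.  The proof is combinatorial, in the manner of Kerr
and Li.  A finite family [A] of sets is independent along a set [J] of times
when every assignment of members of [A] to the times in [J] is realised by an
orbit; it is [rich] when it is independent along arbitrarily large sets of times
of density bounded below.  If [j false], [j true] are two successors of [i0] and
[u], [v] are loops through them, the loops [uv] and [vu] have equal length [N],
so the closures of [L (j false)] and [L (j true)] are independent along an
arithmetic progression of step [N] ([rich_branches]).

Richness survives two operations.  Members of the family can be replaced by
pieces of arbitrarily small diameter ([rich_split], [rich_shrink]); this is a
Sauer-Shelah argument with a linear bound, in the form of Karpinski and Milman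
([leq_card_shatter], [monochromatic_shattering]).  And for arbitrarily large [h]
the family of all sets of points lying in [A i] now and in [A j] at time [h] is
rich as well ([rich_shift]), because a set of positive density contains some
difference [h] with positive density.

Alternating the two produces closed sets indexed by binary words, decreasing
along prefixes, such that at each stage there is a time at which all the sets of
the stage lie together within a small diameter, and another time at which each
set lies in the starting set designated by the last letter of its word
([exists_refines]).  Compactness gives a point for every infinite binary
sequence; any two of them are proximal, and they are separated infinitely often
as soon as the sequences differ infinitely often ([rich_pair_li_yorke]).  *)

Set Implicit Arguments.
Unset Strict Implicit.
Unset Printing Implicit Defensive.

Import Order.TTheory GRing.Theory Num.Theory.
Import numFieldNormedType.Exports.

Local Open Scope classical_set_scope.

(** * Shattering in sets of words *)

Lemma sum_tuple_cons (I : finType) (n : nat) (F : seq I -> nat) :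
  \sum_(w : n.+1.-tuple I) F w = \sum_(a : I) \sum_(w : n.-tuple I) F (a :: w).
Proof.
rewrite pair_big /=.
rewrite (reindex (fun u : I * n.-tuple I => [tuple of u.1 :: u.2])) //=.
exists (fun w : n.+1.-tuple I => (thead w, [tuple of behead w])) => [[a w] _|w _] /=.
  by congr pair; apply/val_inj.
by apply/val_inj => /=; case: w => [[|a s]].
Qed.

Lemma sum_tuple0 (I : finType) (F : seq I -> nat) :
  \sum_(w : 0.-tuple I) F w = F [::].
Proof.
by rewrite (big_pred1 [tuple]) // => w; rewrite (tuple0 w) /= eqxx.
Qed.

(** Patterns on the positions selected by [m] are given by full words [v], so
that restricting to fewer positions needs no padding of the pattern. *)
Definition shatters (I : eqType) (n : nat) (P : pred (seq I)) (m : bitseq) : Prop :=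
  forall v, size v = n -> exists w, [/\ size w = n, P w & mask m w = mask m v].

(** The generalisation of the Sauer-Shelah bound to alphabets with more than two
letters, due to Karpinski and Milman.  Split words at the first letter: a tail
either follows all letters, and then a shattered mask of the set [V] of these
tails extends by the first position, or it follows at most [#|I| - 1] letters.
Instead of a sum of binomial coefficients the bound is in the form of a single
power with a free weight [1 / t] per shattered position, which closes the
induction and is sharp enough for a linear number of positions. *)
Lemma leq_card_shatter (I : finType) (t n M : nat) (P : pred (seq I)) :
  (0 < t)%N ->
  (forall m, size m = n -> count id m = M -> ~ shatters n P m) ->
  t ^ n * \sum_(w : n.-tuple I) P w <= t ^ M * (t * #|I|.-1 + 1) ^ n.
Proof.
move=> t0; elim: n M P => [|n IHn] M P noshat.
  rewrite (sum_tuple0 (fun w => P w : nat)) expn0 mul1n.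
  by rewrite muln1 (@leq_trans 1) ?leq_b1 ?expn_gt0 ?t0.
case: M noshat => [|M] noshat.
  rewrite big1 ?muln0 // => w _; case Pw: (P w) => //; exfalso.
  apply: (noshat (nseq n.+1 false)); rewrite ?size_nseq ?count_nseq //.
  move=> v _; exists (w : seq I).
  by split; rewrite ?size_tuple // (mask_false w n.+1) (mask_false v n.+1).
pose U (w : seq I) := [exists a, P (a :: w)].
pose V (w : seq I) := [forall a, P (a :: w)].
have UV (w : seq I) : \sum_(a : I) P (a :: w) <= #|I|.-1 * U w + V w.
  have sumE : \sum_(a : I) P (a :: w) = #|[pred a | P (a :: w)]|.
    by rewrite -sum1_card [RHS]big_mkcond /=; apply: eq_bigr => a _; rewrite inE; case: (P _).
  rewrite sumE; have [Vw|] := boolP (V w).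
    case: (pickP [pred a | P (a :: w)]) => [a0 _|P0]; last by rewrite (eq_card0 P0).
    have -> : U w by apply/existsP; exists a0; apply: (forallP Vw).
    by rewrite muln1 addn1 (leq_trans (max_card _)) // leqSpred.
  rewrite negb_forall => /existsP[a0 /negP Pa0]; rewrite addn0.
  have [Uw|Uw] := boolP (U w).
    rewrite muln1 -(cardC1 a0); apply/subset_leq_card/fintype.subsetP => a; rewrite !inE.
    by apply: contraTneq => ->; apply/negP.
  rewrite muln0 leqn0; apply/eqP/eq_card0 => a; rewrite !inE.
  by apply/negbTE; move: Uw; rewrite negb_exists => /forallP.
have HU : t ^ n * \sum_(w : n.-tuple I) U w <= t ^ M.+1 * (t * #|I|.-1 + 1) ^ n.
  apply: IHn => m sm cm shU; apply: (noshat (false :: m)) => /= [|//|[//|b v] [sv]].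
    by rewrite sm.
  have [w [sw /existsP[a Pa] mw]] := shU v sv.
  by exists (a :: w); split => //=; rewrite sw.
have HV : t ^ n * \sum_(w : n.-tuple I) V w <= t ^ M * (t * #|I|.-1 + 1) ^ n.
  apply: IHn => m sm cm shV; apply: (noshat (true :: m)) => /= [||v].
  - by rewrite sm.
  - by rewrite cm.
  - case: v => [//|a v] [sv].
    have [w [sw /forallP Pa mw]] := shV v sv.
    by exists (a :: w); split => //=; rewrite ?sw // mw.
rewrite (sum_tuple_cons _ (fun w => P w : nat)) exchange_big /=.
have Hs : \sum_(w : n.-tuple I) \sum_(a : I) P (a :: w) <=
    #|I|.-1 * (\sum_(w : n.-tuple I) U w) + \sum_(w : n.-tuple I) V w.
  by rewrite big_distrr -big_split; apply: leq_sum => w _; exact: UV.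
move: Hs HU HV; rewrite !expnS => Hs HU HV.
set B := (_ + 1) ^ n in HU HV *.
apply: (leq_trans (leq_mul (leqnn (t * t ^ n)) Hs)).
rewrite (_ : t * t ^ M * ((t * #|I|.-1 + 1) * B) =
  t * #|I|.-1 * (t * t ^ M * B) + t * (t ^ M * B)); last by lia.
rewrite mulnDr; apply: leq_add; last by rewrite -mulnA leq_mul2l HV orbT.
rewrite (_ : t * t ^ n * (#|I|.-1 * _) = t * #|I|.-1 * (t ^ n * \sum_(w : n.-tuple I) U w)); last by lia.
by rewrite leq_mul2l HU orbT.
Qed.

(** The guess [e] predicts the colours [c] at all positions where [w] has the
letter [a0]. *)
Definition agree (I M : eqType) (a0 : I) (w : seq I) (c e : seq M) : bool :=
  all (fun u => (u.1 == a0) ==> (u.2.1 == u.2.2)) (zip w (zip c e)).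

Lemma agree_nth (I M : eqType) (a0 : I) (y0 : M) (n : nat) w c e i :
  size w = n -> size c = n -> size e = n -> agree a0 w c e -> (i < n)%N ->
  nth a0 w i = a0 -> nth y0 c i = nth y0 e i.
Proof.
move=> sw sc se /(all_nthP (a0, (y0, y0))) /(_ i) + lti wi.
rewrite !size_zip sw sc se !minnn !nth_zip ?size_zip ?sw ?sc ?se ?minnn //=.
by move=> /(_ lti); rewrite wi eqxx => /eqP.
Qed.

Lemma sum_agree (I M : finType) (a0 : I) (n : nat) (w : seq I) (c : seq M) :
  size w = n -> size c = n ->
  \sum_(e : n.-tuple M) agree a0 w c e =
  \prod_(a <- w) (if a == a0 then 1 else #|M|).
Proof.
elim: n w c => [|n IHn] [|a w] [|b c] //=.
  by rewrite (sum_tuple0 (fun e => agree a0 [::] [::] e : nat)) big_nil.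
move=> [sw] [sc]; rewrite (sum_tuple_cons _ (fun e => agree a0 (a :: w) (b :: c) e : nat)).
rewrite big_cons -(IHn w c) //.
rewrite /agree /=; case: eqP => _ /=; last first.
  by rewrite sum_nat_const.
rewrite (bigD1 b) //= eqxx /= [X in _ + X]big1 ?addn0 ?mul1n //.
by move=> d; rewrite eq_sym => /negbTE ->; rewrite big1.
Qed.

Lemma sum_tuple_prod (I : finType) (F : I -> nat) (n : nat) :
  \sum_(w : n.-tuple I) \prod_(a <- w) F a = (\sum_a F a) ^ n.
Proof.
elim: n => [|n IHn].
  by rewrite (sum_tuple0 (fun w => \prod_(a <- w) F a)) big_nil.
rewrite (sum_tuple_cons _ (fun w => \prod_(a <- w) F a)) expnS -IHn big_distrl /=.
by apply: eq_bigr => a _; rewrite big_distrr; apply: eq_bigr => w _; rewrite big_cons.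
Qed.

(** Averaging over all guesses: a word with [k] letters other than [a0] agrees
with [#|M| ^ k] of the [#|M| ^ n] guesses, and these contributions add up to the
left-hand side by the multinomial formula. *)
Lemma exists_popular_agree (I M : finType) (a0 : I) (n : nat)
    (c : seq I -> seq M) :
  (0 < #|M|)%N -> (forall w, size w = n -> size (c w) = n) ->
  exists e : n.-tuple M, (#|M| * #|I|.-1 + 1) ^ n <=
    #|M| ^ n * \sum_(w : n.-tuple I) agree a0 w (c w) e.
Proof.
move=> M0 sc; apply/existsP; rewrite -[X in is_true X]negbK negb_exists.
apply/negP => /forallP H.
have E : \sum_(e : n.-tuple M) \sum_(w : n.-tuple I) agree a0 w (c w) e =
    (#|M| * #|I|.-1 + 1) ^ n.
  rewrite exchange_big /=; under eq_bigr => w _.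
    rewrite (@sum_agree _ _ a0 n w (c w)) ?sc ?size_tuple //. over.
  rewrite sum_tuple_prod; congr (_ ^ n).
  rewrite (bigD1 a0) //= eqxx addnC; congr addn.
  rewrite (eq_bigr (fun=> #|M|)); last by move=> a /negbTE ->.
  by rewrite sum_nat_const -(cardC1 a0) mulnC.
have : \sum_(e : n.-tuple M)
    (#|M| ^ n * \sum_(w : n.-tuple I) agree a0 w (c w) e + 1)
   <= \sum_(e : n.-tuple M) (#|M| * #|I|.-1 + 1) ^ n.
  by apply: leq_sum => e _; rewrite addn1 ltnNge H.
rewrite big_split -big_distrr /= E !sum_nat_const card_tuple muln1.
by rewrite -[X in _ <= X]addn0 leq_add2l leqn0 expn_eq0 (gtn_eqF M0).
Qed.

(** Makes explicit that exponentials in [n] of different bases are separated by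
a factor [C ^ M] with [M] linear in [n]; it follows from Bernoulli's inequality
[2 * b ^ b <= b.+1 ^ b] for positive [b]. *)
Lemma exp_succ_gap (b C : nat) :
  exists2 L, (0 < L)%N & forall n M, (0 < M)%N -> L * M <= n ->
    C ^ M * b ^ n < b.+1 ^ n.
Proof.
have [->|b0] := posnP b.
  exists 1 => // n M M0; rewrite mul1n => Mn.
  by rewrite exp0n ?(leq_trans M0) // muln0 exp1n.
(* In b steps the ratio grows by a factor 2, and 2 ^ C.+1 exceeds C.+1. *)
exists (b * C.+1) => [|n M M0 LMn]; first by rewrite muln_gt0 b0.
have two : 2 * b ^ b <= b.+1 ^ b.
  rewrite -[b.+1]addn1 expnDn -(ltn_predK b0) big_ord_recl big_ord_recl /= (ltn_predK b0).
  rewrite bin0 bin1 !exp1n subn0 !mul1n !muln1.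
  have -> : bump 0 0 = 1 by [].
  have -> : b * b ^ (b - 1) = b ^ b by rewrite -expnS subn1 prednK.
  by rewrite mul2n -addnn leq_add2l leq_addr.
have L1 : C.+1 * b ^ (b * C.+1) <= b.+1 ^ (b * C.+1).
  rewrite !expnM (@leq_trans ((2 * b ^ b) ^ C.+1)) ?leq_exp2r //.
  by rewrite expnMn leq_mul2r (ltnW (ltn_expl _ _)) ?orbT.
have L2 : C.+1 ^ M * b ^ (b * C.+1 * M) <= b.+1 ^ (b * C.+1 * M).
  by rewrite !(expnM _ (b * C.+1)) -expnMn leq_exp2r.
rewrite -(subnK LMn) !expnD.
apply: (@leq_trans (C.+1 ^ M * (b ^ (n - b * C.+1 * M) * b ^ (b * C.+1 * M)))).
  by rewrite ltn_pmul2r ?ltn_exp2r // muln_gt0 !expn_gt0 b0.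
rewrite mulnCA; apply: leq_mul L2; case: (n - _) => [|k]; first by rewrite !expn0.
by rewrite leq_exp2r.
Qed.

Lemma mask_eq_nth (I : Type) (x0 : I) (n : nat) (m : bitseq) (w u : seq I) (i : nat) :
  size m = n -> size w = n -> size u = n -> mask m w = mask m u ->
  nth false m i -> nth x0 w i = nth x0 u i.
Proof.
elim: n m w u i => [|n IHn] [|b m] [|a w] [|a' u] // i [sm] [sw] [su].
by case: b => [[<- mw]|mw]; case: i => //= i; apply: IHn.
Qed.

(** If every word carries a colouring of its positions, then on a positive
proportion of the positions all patterns are realised by words whose occurrences
of [a0] have a single colour.  Fix a popular guess; the words that agree with it
are exponentially more than [(#|I| - 1) ^ n], hence shatter a linear number of
positions, and on those the guess is constant on at least one position out of
[#|M|]. *)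
Lemma monochromatic_shattering (I M : finType) (a0 : I) (y0 : M) :
  exists2 K, (0 < K)%N & forall n (c : seq I -> seq M),
  (forall w, size w = n -> size (c w) = n) ->
  exists y W, [/\ uniq W, all (ltn^~ n) W, n <= K * (size W).+1 &
    forall u, size u = n -> exists2 w, size w = n &
      forall i, i \in W -> nth a0 w i = nth a0 u i /\
        (nth a0 u i = a0 -> nth y0 (c w) i = y)].
Proof.
have M0 : (0 < #|M|)%N by apply/card_gt0P; exists y0.
(* With weight 1 / t the shattering bound has base (k - 1) + 1 / (2 #|M|), where
   k is the number of letters, against (k - 1) + 1 / #|M| for the words that
   agree with a popular guess. *)
set t := #|M|.*2.
have t0 : (0 < t)%N by rewrite double_gt0.
have [L L0 gap] := exp_succ_gap (t * #|I|.-1 + 1) t.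
exists (L * #|M|.+1) => [|n c sc]; first by rewrite muln_gt0 L0.
have [nL|Ln] := ltnP n L.
  exists y0, [::]; split => //; first by rewrite /= muln1; lia.
  by move=> u su; exists u.
have [e He] := exists_popular_agree a0 M0 sc.
have [m [sm cm sh]] : exists m, [/\ size m = n, count id m = n %/ L &
    shatters n (fun w => agree a0 w (c w) e) m].
  apply: contrapT => nosh.
  have H2 := @leq_card_shatter _ t n (n %/ L) (fun w => agree a0 w (c w) e) t0
    (fun m sm cm shm => nosh (ex_intro _ m (And3 sm cm shm))).
  have H1 := gap n (n %/ L); rewrite divn_gt0 // Ln mulnC leq_trunc_div in H1.
  have := leq_ltn_trans H2 (H1 isT isT).
  rewrite ltnNge => /negP; apply.
  have -> : (t * #|I|.-1 + 1).+1 = 2 * (#|M| * #|I|.-1 + 1) by lia.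
  by rewrite /t -mul2n !expnMn -mulnA leq_mul2l He orbT.
pose W y := [seq i <- iota 0 n | nth false m i && (nth y0 e i == y)].
have [y Hy] : exists y, count id m <= #|M| * size (W y).
  apply/existsP; rewrite -[X in is_true X]negbK negb_exists.
  apply/negP => /forallP H.
  have E : \sum_(y : M) size (W y) = count id m.
    under eq_bigr => y _ do rewrite -sum1_size big_filter big_mkcond /=.
    rewrite exchange_big /= -sum1_count [RHS]big_mkcond (big_nth false) sm /index_iota subn0.
    apply: eq_bigr => i _; case: (nth false m i); last by rewrite big1.
    rewrite (bigD1 (nth y0 e i)) //= eqxx big1 // => y.
    by rewrite eq_sym => /negbTE ->.
  have : \sum_(y : M) (#|M| * size (W y) + 1) <= \sum_(y : M) count id m.
    by apply: leq_sum => y _; rewrite addn1 ltnNge H.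
  rewrite big_split -big_distrr /= E !sum_nat_const muln1.
  by rewrite -[X in _ <= X]addn0 leq_add2l leqn0 (gtn_eqF M0).
exists y, (W y); split.
- by rewrite filter_uniq ?iota_uniq.
- by apply/allP => i; rewrite mem_filter mem_iota => /andP[_ /andP[]].
- have nL := ltn_ceil n L0; rewrite -cm in nL.
  apply: (leq_trans (ltnW nL)); rewrite mulnC -mulnA leq_mul2l; apply/orP; right.
  by rewrite mulnS mulSn (leq_ltn_trans Hy) // addSn ltnS addnA leq_addl.
move=> u su; have [w [sw ag mw]] := sh u su; exists w => // i.
rewrite mem_filter mem_iota add0n /= => /andP[/andP[mi /eqP yi] lti].
have E : nth a0 w i = nth a0 u i.
  exact: (mask_eq_nth a0 sm sw su mw mi).
split => // ui; rewrite -yi; apply: (agree_nth y0 sw _ _ ag) => //.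
- exact: sc.
- exact: size_tuple.
- by rewrite E.
Qed.

(** * Independence along dense sets of times *)

Definition independent (X I : Type) (T : X -> X) (A : I -> set X) (J : seq nat) : Prop :=
  forall f : nat -> I, exists x, forall j, j \in J -> A (f j) (iter j T x).

(** The times lie below [K * size J], so [1 / K] bounds the density of [J] from
below.  Requiring such sets of unbounded size only, rather than of each size,
keeps pigeonhole arguments over finitely many families elementary. *)
Definition dense_independent (X I : Type) (T : X -> X) (A : I -> set X) (K : nat) : Prop :=
  forall N, exists J, [/\ N <= size J, uniq J, all (ltn^~ (K * size J)) J &
    independent T A J].

Definition rich (X I : Type) (T : X -> X) (A : I -> set X) : Prop :=
  exists K, dense_independent T A K.

Lemma pigeonhole_unbounded (M : finType) (Q : M -> nat -> Prop) :
  (forall a N N', N <= N' -> Q a N' -> Q a N) ->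
  (forall N, exists a, Q a N) -> exists a, forall N, Q a N.
Proof.
move=> Qanti Qex; apply: contrapT => /forallNP noQ.
have /choice[b bP] : forall a, exists N, ~ Q a N.
  by move=> a; apply/existsNP; exact: noQ.
have [a] := Qex (\max_a b a).
by move/(Qanti a (b a)) => /(_ (leq_bigmax a)) /(bP a).
Qed.

Lemma rich_sub (X I I' : Type) (T : X -> X) (A : I -> set X) (A' : I' -> set X)
    (g : I' -> I) :
  (forall i, A (g i) `<=` A' i) -> rich T A -> rich T A'.
Proof.
move=> AA' [K dA]; exists K => N; have [J [NJ uJ aJ iJ]] := dA N.
exists J; split => // f; have [x xP] := iJ (g \o f).
by exists x => j jJ; apply: AA'; exact: xP.
Qed.

(** Common scheme of the two operations on rich families: a proportional part
[J'] of each [J] is independent for one of finitely many new families, and some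
family occurs for arbitrarily large [J]. *)
Lemma rich_thin (X I I' : Type) (M : finType) (T : X -> X) (A : I -> set X)
    (A' : M -> I' -> set X) (K K0 : nat) :
  dense_independent T A K ->
  (forall J, uniq J -> all (ltn^~ (K * size J)) J -> independent T A J ->
    exists y J', [/\ uniq J', {subset J' <= J}, size J <= K0 * (size J').+1 &
      independent T (A' y) J']) ->
  exists y, rich T (A' y).
Proof.
move=> dA thin.
suff [y yP] : exists y, forall N, exists J, [/\ N <= size J, uniq J,
    all (ltn^~ (K * K0 * 2 * size J)) J & independent T (A' y) J].
  by exists y, (K * K0 * 2).
apply: pigeonhole_unbounded => [y N N' NN' [J [N'J uJ aJ iJ]]|N].
  by exists J; split => //; exact: leq_trans N'J.
(* The margin makes J' nonempty, to absorb the successor in the bound on J. *)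
have [J [NJ uJ aJ iJ]] := dA (K0 * N.+2).+1.
have [y [J' [uJ' J'J sJ iJ']]] := thin J uJ aJ iJ.
have := leq_trans NJ sJ; rewrite ltn_mul2l => /andP[K00 NJ'].
rewrite ltnS in NJ'; exists y, J'; split => //; first by rewrite ltnW // ltnW.
apply/allP => j /J'J /(allP aJ) /= jJ; apply: (leq_trans jJ).
rewrite -!mulnA leq_mul2l; apply/orP; right; apply: (leq_trans sJ).
by rewrite leq_mul2l mul2n -addnn -addn1 leq_add2l (leq_ltn_trans _ NJ') ?orbT.
Qed.

(** Choose a point for each word of itineraries along [J] and colour the time
[j] by the piece, under [p], that the orbit of the point visits at time [j]. *)
Lemma rich_split1 (X : Type) (I M : finType) (T : X -> X) (A : I -> set X) (p : X -> M)
    (a0 : I) :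
  rich T A ->
  exists y, rich T (fun a => if a == a0 then A a `&` p @^-1` [set y] else A a).
Proof.
move=> [K dA].
have [y0 _] : exists y0 : M, True.
  have [J [_ _ _ iJ]] := dA 0; have [x _] := iJ (fun=> a0); by exists (p x).
have [K0 K00 shat] := monochromatic_shattering a0 y0.
apply: (rich_thin (K := K) (K0 := K0) (A' := fun y a =>
  if a == a0 then A a `&` p @^-1` [set y] else A a) dA) => J uJ aJ iJ.
have /choice[x xP] : forall w : seq I, exists x, forall j, j \in J ->
    A (nth a0 w (index j J)) (iter j T x).
  by move=> w; exact: (iJ (fun j => nth a0 w (index j J))).
pose c w := [seq p (iter j T (x w)) | j <- J].
have [|y [W [uW /allP aW sW hW]]] := shat (size J) c.
  by move=> w _; rewrite size_map.
exists y, [seq nth 0 J i | i <- W]; split.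
- rewrite map_inj_in_uniq // => i i' /aW iJ' /aW iJ'' /eqP.
  by rewrite nth_uniq // => /eqP.
- by move=> _ /mapP[i /aW iW ->]; rewrite mem_nth.
- by rewrite size_map.
move=> f; have [|w sw wP] := hW [seq f j | j <- J]; first by rewrite size_map.
exists (x w) => _ /mapP[i iW ->]; have iJ' := aW _ iW.
have [] := wP _ iW; rewrite (nth_map 0) // => wi ci.
have := xP w (nth 0 J i) (mem_nth _ iJ'); rewrite index_uniq // wi.
case: eqP => // fi Ax; split => //=.
by have := ci fi; rewrite (nth_map 0).
Qed.

(** The members of the family are cut one after the other; if all of them
were cut at once, the words agreeing with a popular guess would be too few to
force shattering. *)
Lemma rich_split (X : Type) (I M : finType) (T : X -> X) (A : I -> set X) (p : X -> M)
    (y0 : M) :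
  rich T A -> exists y : I -> M, rich T (fun a => A a `&` p @^-1` [set y a]).
Proof.
move=> rA.
suff H (s : seq I) : exists y : I -> M,
    rich T (fun a => if a \in s then A a `&` p @^-1` [set y a] else A a).
  have [y ry] := H (enum I); exists y; apply: (rich_sub (g := id)) ry => a /=.
  by rewrite mem_enum.
elim: s => [|b s [y ry]]; first by exists (fun=> y0).
have [y1 ry1] := rich_split1 p b ry.
exists (fun a => if a == b then y1 else y a); apply: (rich_sub (g := id)) ry1 => a /=.
by rewrite inE; case: eqP => /= _; case: ifP => _ x // [[? _] ?].
Qed.

Lemma sorted_ltn_index_gap (J : seq nat) (i k : nat) :
  sorted ltn J -> i + k < size J -> nth 0 J i + k <= nth 0 J (i + k).
Proof.
move=> sJ; elim: k => [|k IHk] ik; first by rewrite !addn0.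
rewrite addnS; apply: (@leq_ltn_trans (nth 0 J (i + k))).
  by apply: IHk; rewrite (leq_trans _ ik) // addnS ltnW.
rewrite addnS in ik.
by apply: (sorted_ltn_nth ltn_trans 0 sJ); rewrite ?inE ?addnS // ltnW.
Qed.

(** Cut the increasing enumeration of [J] into blocks of [H + 1] elements.  The
blocks occupy disjoint intervals, so at least half of them have length below a
constant [C], and one length [h] is taken by a fixed proportion of the blocks.
The first elements of those blocks form [J']; their translates by [h] are the
last elements, and these are not first elements because [H > 0]. *)
Lemma exists_frequent_difference (K H : nat) : 0 < H -> exists2 K0, (0 < K0)%N &
  forall J, uniq J -> all (ltn^~ (K * size J)) J ->
  exists h : 'I_K0, H <= h /\ exists J', [/\ uniq J', {subset J' <= J},
    size J <= K0 * (size J').+1 &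
    forall j, j \in J' -> j + h \in J /\ j + h \notin J'].
Proof.
(* The selected blocks are at least one in 2 C, with H.+1 elements each; K0 is
   their product, which also exceeds the difference in all cases. *)
move=> H0; pose C := (4 * K * H.+1).+1; pose K0 := 2 * C * H.+1.
have HK0 : H < K0 by rewrite /K0 leq_pmull // muln_gt0.
have CK0 : C <= K0 by rewrite /K0 mulnAC leq_pmull // muln_gt0.
exists K0 => [|J uJ aJ]; first exact: leq_trans HK0.
set n : nat := size J; pose s := sort leq J; pose q := n %/ H.+1.
have ss : sorted ltn s.
  by rewrite ltn_sorted_uniq_leq sort_uniq uJ sort_sorted //; exact: leq_total.
have us : uniq s by rewrite sort_uniq.
have sizes : size s = n by rewrite size_sort.
pose a i := nth 0 s (i * H.+1); pose b i := nth 0 s (i * H.+1 + H).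
have ltq i : i < q -> i * H.+1 + H < n.
  by rewrite leq_divRL // mulSn addSn addnC.
have ltn_i i : i < q -> i * H.+1 < n.
  by move=> /ltq; apply: leq_ltn_trans; exact: leq_addr.
have sJ i : i < n -> nth 0 s i \in J.
  by move=> ni; rewrite -(mem_sort leq) mem_nth ?sizes.
have Hab i : i < q -> a i + H <= b i.
  by move=> iq; apply: sorted_ltn_index_gap; rewrite ?sizes ?ltq.
have ba i : i.+1 < q -> b i <= a i.+1.
  move=> iq; rewrite /a mulSn addnC addnS -addn1.
  apply: leq_trans (sorted_ltn_index_gap ss _); first exact: leq_addr.
  by rewrite sizes addn1 -addnS addnC -mulSn ltn_i.
have sumab r : r < q -> \sum_(i < r.+1) (b i - a i) <= b r.
  elim: r => [|r IHr] rq; first by rewrite big_ord_recr big_ord0 /= leq_subr.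
  rewrite big_ord_recr /=.
  apply: leq_trans (leq_add (leq_trans (IHr (ltnW rq)) (ba _ rq)) (leqnn _)) _.
  by rewrite subnKC // (leq_trans _ (Hab _ rq)) ?leq_addr.
have sumKn : \sum_(i < q) (b i - a i) <= K * n.
  case: q sumab ltq ltn_i Hab ba => [|q'] sumab *; first by rewrite big_ord0.
  apply: leq_trans (sumab q' _) _ => //; apply: ltnW; apply: (allP aJ).
  by apply: sJ; auto.
pose G h := [seq i <- iota 0 q | b i - a i == h].
have nq : n < q.+1 * H.+1 by exact: ltn_ceil.
have C0 : 0 < C by [].
pose good := \sum_(i < q) (b i - a i < C); pose bad := \sum_(i < q) (C <= b i - a i).
have sumG : \sum_(h < C) size (G h) = good.
  under eq_bigr => h _ do rewrite -sum1_size big_filter big_mkcond /=.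
  rewrite exchange_big /= /good -(big_mkord xpredT (fun i => (b i - a i < C) : nat)).
  rewrite /index_iota subn0; apply: eq_bigr => i _; case: ltnP => hi.
    rewrite (bigD1 (Ordinal hi)) //= eqxx big1 // => h.
    by rewrite eq_sym => /negbTE hh; case: eqP => // e; case/eqP: hh; apply: val_inj.
  by rewrite big1 // => h _; case: eqP => // e; move: hi; rewrite e leqNgt ltn_ord.
have gb : good + bad = q.
  rewrite /good /bad -big_split /= -[RHS]card_ord -sum1_card; apply: eq_bigr => i _.
  by case: ltnP.
have badC : C * bad <= K * n.
  apply: leq_trans sumKn; rewrite big_distrr; apply: leq_sum => i _ /=.
  by case: (leqP C) => //; rewrite ?muln1 ?muln0.
have key : q <= 2 * good.
  have [->//|q0] := posnP q; suff : 2 * bad <= q by lia.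
  rewrite -(leq_pmul2l C0); apply: (@leq_trans (2 * (K * n))); first by lia.
  apply: (@leq_trans (2 * (K * (2 * q * H.+1)))).
    rewrite !leq_mul2l /=; apply/orP; right; apply: (leq_trans (ltnW nq)).
    by rewrite leq_mul2r /=; lia.
  by rewrite /C mulSn; lia.
have [h Gh] : exists h : 'I_C, q <= 2 * C * size (G h).
  apply/existsP; rewrite -[X in is_true X]negbK negb_exists.
  apply/negP => /forallP F.
  have : \sum_(h < C) (2 * C * size (G h) + 1) <= \sum_(h < C) q.
    by apply: leq_sum => h _; rewrite addn1 ltnNge F.
  rewrite big_split -big_distrr /= sumG !sum_nat_const card_ord muln1 => F1.
  suff : C * q < C * q by rewrite ltnn.
  apply: leq_trans F1; rewrite (mulnC 2) -mulnA.
  by apply: (@leq_ltn_trans (C * (2 * good))); rewrite ?leq_mul2l ?key ?orbT // -[X in X < _]addn0 ltn_add2l.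
have sKG : n <= K0 * (size (G h)).+1.
  apply: (leq_trans (ltnW nq)).
  rewrite /K0 mulnAC leq_mul2r /=.
  by rewrite mulnS addnC -addn1 leq_add // muln_gt0.
(* If no block has difference h, the bound sKG makes J short and the empty set
   serves with the difference H. *)
have [G0|G0] := posnP (size (G h)).
  by exists (Ordinal HK0); split => //; exists [::]; split => //; move: sKG; rewrite G0.
have inG i : i \in G h -> i < q /\ b i - a i = h.
  by rewrite mem_filter mem_iota => /andP[/eqP ? /andP[]].
exists (widen_ord CK0 h); split => /=.
  have [iq <-] := inG _ (mem_nth 0 G0).
  by rewrite leq_subRL ?Hab // (leq_trans _ (Hab _ iq)) ?leq_addr.
have abh i : i \in G h -> a i + h = b i.
  move=> /inG[iq <-]; rewrite addnC subnK //.
  by rewrite (leq_trans _ (Hab _ iq)) ?leq_addr.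
exists [seq a i | i <- G h]; split.
- rewrite map_inj_in_uniq ?filter_uniq ?iota_uniq // => i i' /inG[iq _] /inG[i'q _].
  move/eqP; rewrite nth_uniq ?sizes ?ltn_i // eqn_pmul2r //.
  by move/eqP.
- by move=> _ /mapP[i /inG[iq _] ->]; exact/sJ/ltn_i.
- by rewrite size_map.
move=> _ /mapP[i iG ->]; rewrite abh //; have [iq _] := inG _ iG.
split; first exact/sJ/ltq.
apply/mapP => -[i' /inG[i'q _]] /eqP; rewrite nth_uniq ?sizes ?ltn_i ?ltq //.
move/eqP/(congr1 (modn^~ H.+1)); rewrite modnMDl modnMl modn_small //.
by move=> H00; rewrite H00 in H0.
Qed.

(** Along [J'] from [exists_frequent_difference] the times [j] and [j + h] are
all distinct, so the two coordinates can be prescribed independently. *)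
Lemma rich_shift (X I : Type) (T : X -> X) (A : I -> set X) (a : I) (H : nat) :
  rich T A -> exists h, H <= h /\
    rich T (fun u : I * I => A u.1 `&` iter h T @^-1` A u.2).
Proof.
move=> [K dA].
have [K0 K00 freq] := exists_frequent_difference K (ltn0Sn H).
have : exists h : 'I_K0, rich T (fun u : I * I => [set x | H < h] `&`
     (A u.1 `&` iter h T @^-1` A u.2)).
  apply: (rich_thin (K := K) (K0 := K0) (A' := fun (h : 'I_K0) (u : I * I) =>
    [set x | H < h] `&` (A u.1 `&` iter h T @^-1` A u.2)) dA) => J uJ aJ iJ.
  have [h [Hh [J' [uJ' J'J sJ hP]]]] := freq J uJ aJ.
  exists h, J'; split => // f.
  have [x xP] := iJ (fun j => if j \in J' then (f j).1 else (f (j - h)).2).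
  exists x => j jJ'; split => //; split.
    by have := xP j (J'J _ jJ'); rewrite jJ'.
  have [jhJ /negbTE jhJ'] := hP j jJ'.
  by have := xP _ jhJ; rewrite jhJ' addnK /= addnC iterD.
move=> [h rh]; exists h; split; last first.
  by apply: (rich_sub (g := id)) rh => u x [].
have [K' /(_ 1)[J [J0 _ _ iJ]]] := rh.
have [x xP] := iJ (fun=> (a, a)).
by have [/ltnW] := xP _ (mem_nth 0 J0).
Qed.

Local Open Scope ring_scope.

(** * From a rich separated pair to an uncountable scrambled set *)

(** If there is no net, the complements of finite unions of [e]-balls generate a proper
filter, which cannot have a cluster point. *)
Lemma compact_finite_net (R : realType) (X : metricType R) (e : R) :
  compact [set: X] -> 0 < e ->
  exists (M : finType) (c : M -> X), forall y, exists i, mdist (c i) y < e.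
Proof.
move=> cX e0; apply: contrapT => nonet.
pose F : set_system X := [set B | exists (M : finType) (c : M -> X),
  forall y, ~ B y -> exists i, mdist (c i) y < e].
have FF : ProperFilter F.
  split; first by move=> [M [c cP]]; apply: nonet; exists M, c => y; exact: cP.
  split.
  - by exists void, (fun v : void => match v with end) => y /(_ I).
  - move=> B C [M [c cP]] [M' [c' cP']].
    exists (M + M')%type, (fun v => match v with inl i => c i | inr i => c' i end).
    move=> y /not_andP[/cP|/cP'] [i iy]; first by exists (inl i).
    by exists (inr i).
  - by move=> B C BC [M [c cP]]; exists M, c => y nCy; apply: cP => /BC.
have [x [_ xF]] := cX F FF filterT.
have Fx : F (~` [set y | mdist x y < e]).
  by exists unit, (fun=> x) => y /contrapT yx; exists tt.
have [y [/= ny]] := xF _ _ Fx (nbhsx_ballx x e e0).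
by rewrite ballEmdist.
Qed.

Lemma closed_mdist_le (R : realType) (X : metricType R) (c : X) (e : R) :
  closed [set y | mdist c y <= e].
Proof.
move=> y yc; apply/ler_addgt0Pl => d d0.
have [z [/= cz]] := yc _ (nbhsx_ballx y d d0); rewrite ballEmdist /= => yz.
rewrite (le_trans (metric_triangle c z y)) // addrC lerD // metric_sym.
exact: ltW.
Qed.

Lemma continuous_iter (X : topologicalType) (T : X -> X) (n : nat) :
  continuous T -> continuous (iter n T).
Proof.
move=> cT; elim: n => [|n IHn] x /=; first exact: cvg_id.
by apply: (@continuous_comp _ _ _ (iter n T) T); [exact: IHn|exact: cT].
Qed.

Lemma compact_nested (X : topologicalType) (F : nat -> set X) :
  compact [set: X] -> (forall r, closed (F r)) -> (forall r, F r !=set0) ->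
  (forall r, F r.+1 `<=` F r) -> exists x, forall r, F r x.
Proof.
move=> cX cF /choice[y yF] dF.
have mF r s : (r <= s)%N -> F s `<=` F r.
  elim: s => [|s IHs]; first by rewrite leqn0 => /eqP ->.
  rewrite leq_eqVlt => /orP[/eqP -> //|rs]; exact: subset_trans (dF s) (IHs rs).
have [x [_ xF]] := cX (y @ \oo) _ filterT.
exists x => r; apply: cF => B xB; apply: xF => //.
by exists r => // s /= rs; apply: (mF r s rs).
Qed.

Lemma limn_einf_eq0 (R : realType) (u : nat -> R) :
  (forall n, 0 <= u n) ->
  (forall e, 0 < e -> forall N, exists2 n, (N <= n)%N & u n <= e) ->
  limn_einf (fun n => (u n)%:E) = 0%E.
Proof.
move=> u0 uS; rewrite limn_einf_lim.
apply: cvg_lim => //; rewrite (_ : einfs _ = cst 0%E); first exact: cvg_cst.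
apply/funext => N; apply/eqP; rewrite eq_le; apply/andP; split.
  apply/lee_addgt0Pr => e e0; rewrite add0e; have [n Nn un] := uS e e0 N.
  by apply: (@le_trans _ _ (u n)%:E); [apply: ereal_inf_lbound; exists n|rewrite lee_fin].
by apply: le_ereal_inf_tmp => _ [n _ <-]; rewrite lee_fin.
Qed.

Lemma limn_esup_ge (R : realType) (u : nat -> R) (d : R) :
  (forall N, exists2 n, (N <= n)%N & d <= u n) ->
  (d%:E <= limn_esup (fun n => (u n)%:E))%E.
Proof.
move=> uS; rewrite limn_esup_lim.
rewrite (_ : limn _ = ereal_inf (range (esups (fun n => (u n)%:E)))); last first.
  by apply/cvg_lim => //; exact: cvg_esups_inf.
apply: le_ereal_inf_tmp => _ [N _ <-]; have [n Nn un] := uS N.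
by apply: (@le_trans _ _ (u n)%:E); [rewrite lee_fin|apply: ereal_sup_ubound; exists n].
Qed.

(** Cantor's diagonal argument, along the partial inverse of [g]. *)
Lemma injective_binary_to_nat (g : (nat -> bool) -> nat) : injective g -> False.
Proof.
move=> ginj; pose d n := `[< forall s, g s = n -> s n = false >].
case dn : (d (g d)); first by move: (dn) => /asboolP /(_ d erefl); rewrite dn.
move/asboolPn : (negbT dn) => /existsNP[s /not_implyP[gs]].
by rewrite (ginj _ _ gs) dn.
Qed.

(** Binary words with [r + 1] letters, the last letter in front, so that [w.2] is
the prefix from which [w] is obtained. *)
Fixpoint word (r : nat) : finType :=
  if r is r'.+1 then (bool * word r')%type else bool.

Fixpoint const_word (b : bool) (r : nat) : word r :=
  if r is r'.+1 then (b, const_word b r') else b.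

Fixpoint prefix (s : nat -> bool) (r : nat) : word r :=
  if r is r'.+1 then (s r, prefix s r') else s 0%N.

(** Containment of the sets at constant words in [D] is what allows later stages
to steer an orbit into either set of the starting pair. *)
Definition admissible (R : realType) (X : metricType R) (T : X -> X)
    (D : bool -> set X) (r : nat) (A : word r -> set X) : Prop :=
  [/\ forall w, closed (A w), rich T A & forall b, A (const_word b r) `<=` D b].

(** One time brings all sets of the new stage together, which makes points
proximal; another one separates words with different last letters. *)
Definition refines (R : realType) (X : metricType R) (T : X -> X)
    (D : bool -> set X) (r : nat) (A : word r -> set X) (A' : word r.+1 -> set X) : Prop :=
  [/\ forall w, A' w `<=` A w.2,
    exists2 h, (r <= h)%N & forall w w' x y, A' w x -> A' w' y ->
      mdist (iter h T x) (iter h T y) <= r.+1%:R^-1 &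
    exists2 h, (r <= h)%N & forall w x, A' w x -> D w.1 (iter h T x)].

Lemma rich_neq0 (X I : Type) (T : X -> X) (A : I -> set X) (i : I) : rich T A -> A i !=set0.
Proof.
move=> [K /(_ 1%N)[J [J0 _ _ /(_ (fun=> i))[x xP]]]].
by exists (iter (nth 0%N J 0) T x); apply: xP; rewrite mem_nth.
Qed.

Lemma rich_shrink (R : realType) (X : metricType R) (T : X -> X)
    (I : finType) (A : I -> set X) (i0 : I) (e : R) :
  compact [set: X] -> 0 < e ->
  rich T A -> (forall i, closed (A i)) -> exists A' : I -> set X,
    [/\ rich T A', forall i, closed (A' i), forall i, A' i `<=` A i &
     forall i x y, A' i x -> A' i y -> mdist x y <= e].
Proof.
move=> cX e0 rA clA; have [x0 _] := rich_neq0 i0 rA.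
have [M [c /choice[p cP]]] := compact_finite_net cX (divr_gt0 e0 (ltr0n R 2)).
have [y ry] := rich_split p (p x0) rA.
exists (fun i => A i `&` [set x | mdist (c (y i)) x <= e / 2]); split.
- apply: (rich_sub (g := id)) ry => i x [Ax px]; split => //=.
  by rewrite -px ltW.
- by move=> i; apply: closedI => //; exact: closed_mdist_le.
- by move=> i x [].
- move=> i a b [_ /= ca] [_ /= cb].
  rewrite (le_trans (metric_triangle a (c (y i)) b)) // [leRHS]splitr lerD //.
  by rewrite metric_sym.
Qed.

(** First shrink, then use two shifts.  At time [h1] every set is sent to the same
small set, the one at a constant word; at time [h2] it is sent to the set at the
constant word given by the new letter, which lies in the matching [D b]. *)
Lemma exists_refines (R : realType) (X : metricType R) (T : X -> X)
    (D : bool -> set X) (r : nat) (A : word r -> set X) :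
  compact [set: X] -> continuous T -> admissible T D A ->
  exists A', admissible T D A' /\ refines T D A A'.
Proof.
move=> cX cT [clA rA AD].
have eps0 : 0 < (r.+1%:R^-1 : R) by rewrite invr_gt0 ltr0n.
have [A1 [rA1 clA1 A1A dA1]] := rich_shrink (const_word false r) cX eps0 rA clA.
have [h1 [rh1 rA2]] := rich_shift (const_word false r) r rA1.
set A2 := fun u => _ in rA2.
have [h2 [rh2 rA3]] := rich_shift (const_word false r, const_word false r) r rA2.
set A3 := fun u => _ in rA3.
pose g (w : word r.+1) := ((w.2, const_word false r), (const_word w.1 r, const_word false r)).
have clpre h B : closed B -> closed (iter h T @^-1` B).
  by move=> ?; apply: preimage_closed => // x _; exact: continuous_iter.
have clA2 u : closed (A2 u) by apply: closedI; [exact: clA1|exact: (clpre _ _ (clA1 _))].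
have clA3 u : closed (A3 u) by apply: closedI; [exact: clA2|exact: (clpre _ _ (clA2 _))].
exists (fun w => A3 (g w)); split; split.
- by move=> w; exact: clA3.
- by apply: (rich_sub (g := g)) rA3 => w.
- by move=> b x [[Ax _] _]; apply: AD; exact: (A1A _ _ Ax).
- by move=> w x [[Ax _] _]; exact: (A1A _ _ Ax).
- by exists h1 => // w w' x y [[_ hx] _] [[_ hy] _]; exact: dA1 hx hy.
- by exists h2 => // w x [_ [Ax _]]; apply: AD; exact: (A1A _ _ Ax).
Qed.

Lemma exists_admissible_sequence (R : realType) (X : metricType R) (T : X -> X)
    (D : bool -> set X) :
  compact [set: X] -> continuous T ->
  (forall b, closed (D b)) -> rich T D ->
  exists A : forall r, word r -> set X,
    forall r, admissible T D (A r) /\ refines T D (A r) (A r.+1).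
Proof.
move=> cX cT clD rD.
pose state r := {A : word r -> set X | admissible T D A}.
have st0 : state 0%N by exists D; split => // b x.
have step r (st : state r) : {st' : state r.+1 | refines T D (sval st) (sval st')}.
  have [A' [aA' rA']] := cid (exists_refines cX cT (svalP st)).
  by exists (exist _ A' aA').
pose st := nat_rect state st0 (fun r s => sval (step r s)).
exists (fun r => sval (st r)) => r; split; first exact: (svalP (st r)).
exact: (svalP (step r (st r))).
Qed.

(** The nested construction yields a point [x s] for each [s].  Distinct sequences
may differ only once, so the scrambled set consists of the points [x (e s)]
where [e s] repeats each value of [s] infinitely often. *)
Lemma rich_pair_li_yorke (R : realType) (X : metricType R) (T : X -> X)
    (D : bool -> set X) (d : R) :
  compact [set: X] -> continuous T -> (forall b, closed (D b)) -> rich T D ->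
  0 < d -> (forall x y, D false x -> D true y -> d <= mdist x y) ->
  li_yorke_chaotic T.
Proof.
move=> cX cT clD rD d0 dD.
have [A AP] := exists_admissible_sequence cX cT clD rD.
have /choice[x xP] : forall s : nat -> bool, exists x, forall r, A r (prefix s r) x.
  move=> s; apply: compact_nested => // r; have [[clA rA _] [sA _ _]] := AP r.
  - exact: clA.
  - exact: rich_neq0 rA.
  - exact: sA.
(* The 2-adic valuation takes each value infinitely often. *)
pose e (s : nat -> bool) k := s (logn 2 k.+1).
have eP s t : s <> t -> forall N, exists2 r, (N <= r)%N & e s r.+1 <> e t r.+1.
  move=> st N; have [m stm] : exists m, s m <> t m.
    by apply: contrapT => /forallNP H; apply: st; apply/funext => m; apply: contrapT.
  exists (2 ^ m * N.+1.*2.+1 - 2)%N; first by have := expn_gt0 2 m; nia.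
  suff vm : logn 2 (2 ^ m * N.+1.*2.+1 - 2).+2 = m by rewrite /e vm.
  have -> : (2 ^ m * N.+1.*2.+1 - 2).+2 = (2 ^ m * N.+1.*2.+1)%N.
    by have := expn_gt0 2 m; nia.
  rewrite lognM ?expn_gt0 // pfactorK // lognE /= dvdn2 /= odd_double /=.
  by rewrite addn0.
have xe_sep s t : s <> t -> forall N, exists2 n, (N <= n)%N &
    d <= mdist (iter n T (x (e s))) (iter n T (x (e t))).
  move=> st N; have [r Nr] := eP s t st N.
  have [_ [_ _ [h rh hP]]] := AP r.
  have := hP _ _ (xP (e s) r.+1); have := hP _ _ (xP (e t) r.+1) => /=.
  case: (e s r.+1) (e t r.+1) => [] [] // Dt Ds _; exists h; rewrite ?(leq_trans Nr) //.
    by rewrite metric_sym; exact: dD.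
  exact: dD.
have xe_inj : injective (x \o e).
  move=> s t /= xst; apply: contrapT => st; have [n _] := xe_sep s t st 0%N.
  by rewrite xst mdistxx leNgt d0.
exists (range (x \o e)); split.
  move=> /countable_injP[f finj]; apply: (@injective_binary_to_nat (f \o (x \o e))).
  move=> s t /= fst; apply: xe_inj; apply: finj => //; rewrite inE; by eexists.
move=> _ _ [s _ <-] [t _ <-] xst.
have st : s <> t by move=> E; apply: xst; rewrite E.
split.
  apply: limn_einf_eq0 => [n|eps eps0 N]; first exact: mdist_ge0.
  have [k _ /(_ (maxn N k))] := near_infty_natSinv_lt (PosNum eps0).
  move=> /(_ (leq_maxr N k)) /= kP; have [_ [_ [h rh hP] _]] := AP (maxn N k).
  exists h; first by rewrite (leq_trans _ rh) // leq_maxl.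
  exact: le_trans (hP _ _ _ _ (xP _ _) (xP _ _)) (ltW kP).
apply: (@lt_le_trans _ _ d%:E); first by rewrite lte_fin.
by apply: limn_esup_ge; exact: xe_sep.
Qed.

(** * Itineraries in the transition graph *)

Definition transition (p : nat) (A : 'M[nat]_p) : rel 'I_p := fun i j => A i j == 1%N.

Lemma irreducible_connect (p : nat) (A : 'M[nat]_p) :
  transition_matrix A -> irreducible_mx A -> forall i j, connect (transition A) i j.
Proof.
move=> [A01 _ _] irrA i j; have [k _] := irrA i j.
elim: k i => [|k IHk] i.
  by rewrite expr0 mxE; case: eqP => [->|//]; rewrite connect0.
rewrite exprS -mulmxE mxE lt0n sum_nat_eq0 negb_forall => /existsP[l].
rewrite implyTb muln_eq0 negb_or => /andP[Ail Alj].
apply: (@connect_trans _ _ l); last by apply: IHk; rewrite lt0n.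
by apply: connect1; rewrite /transition; case: (A01 i l) Ail => ->.
Qed.

Lemma branching_row (p : nat) (A : 'M[nat]_p) (i : 'I_p) :
  transition_matrix A -> (2 <= \sum_(j < p) A i j)%N ->
  exists j : bool -> 'I_p, injective j /\ forall b, transition A i (j b).
Proof.
move=> [A01 _ _]; rewrite (eq_bigr (fun j => transition A i j : nat)); last first.
  by move=> j _; rewrite /transition; case: (A01 i j) => ->.
rewrite -big_mkcond sum1_card => /card_gt1P[a [b [ia ib ab]]].
exists (fun c => if c then a else b); split; last by case.
by move=> [] [] // /eqP; rewrite ?(negbTE ab) // eq_sym (negbTE ab).
Qed.

(** Backward along the path: a point of the last set is pulled back through the
covering relations. *)
Lemma exists_itinerary (R : realType) (X : metricType R) (T : X -> X) (p : nat)
    (A : 'M[nat]_p) (L : 'I_p -> set X) (v : 'I_p) (w : seq 'I_p) (x : X) :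
  coupled_expanding T A L ->
  path (transition A) v w -> L (last v w) x ->
  exists y, iter (size w) T y = x /\
    forall k, (k <= size w)%N -> L (nth v (v :: w) k) (iter k T y).
Proof.
move=> [_ _ LL].
elim: w v => [|u w IHw] v /=; first by move=> _ Lx; exists x; split => // -[].
move=> /andP[vu uw] Lx; have [y [yx yP]] := IHw u uw Lx.
have [|z Lz zy] := LL v y.
  by exists u; [exact/eqP|exact: (yP 0%N)].
exists z; split; first by rewrite -iterS iterSr zy.
case=> [//|k] /= kw; rewrite -iterS iterSr zy (set_nth_default u) //.
exact: yP.
Qed.

(** The two loops at [i0] through [j false] and [j true] are concatenated in
both orders, to get two loops of equal length [N] that differ right after [i0].
Their free concatenations prescribe the branch at all times [N * k + 1]. *)
Lemma rich_branches (R : realType) (X : metricType R) (T : X -> X) (p : nat)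
    (A : 'M[nat]_p) (L : 'I_p -> set X) (i0 : 'I_p) (j : bool -> 'I_p) :
  coupled_expanding T A L -> (forall i i', connect (transition A) i i') ->
  (forall b, transition A i0 (j b)) -> rich T (fun b => closure (L (j b))).
Proof.
move=> hL conn i0j; have [L0 _ _] := hL.
have /choice[w wP] : forall b, exists w, path (transition A) (j b) w /\ last (j b) w = i0.
  by move=> b; have /connectP[w jw ->] := conn (j b) i0; exists w.
pose u b := (j b :: w b) ++ j (~~ b) :: w (~~ b).
have pu b : path (transition A) i0 (u b).
  have [jw jl] := wP b; have [jw' jl'] := wP (~~ b).
  by rewrite /u cat_path /= !i0j jw jl i0j jw'.
have lu b : last i0 (u b) = i0.
  by have [_ jl'] := wP (~~ b); rewrite /u last_cat /= jl'.
pose N := size (u false).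
have su b : size (u b) = N.
  by rewrite /N /u !size_cat /=; case: b => //=; rewrite addnC.
have N2 : (2 <= N)%N by rewrite /N /u size_cat /= addnS.
have orbit n : forall bs : nat -> bool, exists2 x, L i0 x &
    forall k, (k < n)%N -> L (j (bs k)) (iter (N * k).+1 T x).
  elim: n => [|n IHn] bs; first by have [x Lx] := L0 i0; exists x.
  have [x Lx xP] := IHn (fun k => bs k.+1).
  have Lx' : L (last i0 (u (bs 0%N))) x by rewrite lu.
  have [y [yx yP]] := exists_itinerary hL (pu _) Lx'; rewrite su in yx yP.
  exists y; first exact: (yP 0%N).
  case=> [_|k kn]; first by rewrite muln0; apply: (yP 1%N); exact: ltnW.
  by rewrite mulnS addnC -addSn iterD yx; exact: xP.
exists N => n; exists [seq (N * k).+1 | k <- iota 0 n]; split.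
- by rewrite size_map size_iota.
- rewrite map_inj_uniq ?iota_uniq // => k k' [] /eqP.
  by rewrite eqn_pmul2l ?(ltnW N2) // => /eqP.
- rewrite size_map size_iota; apply/allP => _ /mapP[k + ->] /=.
  rewrite mem_iota => /= kn; apply: (@leq_trans (N * k.+1)).
    by rewrite mulnS -addn2 addnC leq_add2r.
  by rewrite leq_mul2l kn orbT.
- move=> f; have [x _ xP] := orbit n (fun k => f (N * k).+1).
  exists x => _ /mapP[k + ->]; rewrite mem_iota => /= kn.
  by apply: subset_closure; exact: xP.
Qed.

Lemma set_dist_le_closure (R : realType) (X : metricType R) (B C : set X) (x y : X) :
  closure B x -> closure C y -> set_dist B C <= mdist x y.
Proof.
move=> Bx Cy; apply/ler_addgt0Pl => e e0.
have e2 : 0 < e / 2 by rewrite divr_gt0.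
have [b [Bb]] := Bx _ (nbhsx_ballx x _ e2); rewrite ballEmdist /= => xb.
have [c [Cc]] := Cy _ (nbhsx_ballx y _ e2); rewrite ballEmdist /= => yc.
apply: (@le_trans _ _ (mdist b c)).
  apply: ge_inf; last by exists b => //; exists c.
  by exists 0 => _ [b' _ [c' _ <-]]; exact: mdist_ge0.
have := metric_triangle b x c; have := metric_triangle x y c.
by rewrite (metric_sym b x); lra.
Qed.

(** * The lower bound on entropy *)

(** The distance to [i0] in the graph; shortest paths repeat no vertex. *)
Lemma exists_descent (I : finType) (e : rel I) (i0 : I) :
  (forall i, connect e i i0) ->
  exists d : I -> nat, forall v, (d v < #|I|)%N /\
    (v != i0 -> exists j, e v j /\ (d j < d v)%N).
Proof.
move=> conn.
pose P v n := exists w, [/\ path e v w, last v w = i0 & size w = n].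
have exP v : exists n, `[< P v n >].
  by have /connectP[w vw wi] := conn v; exists (size w); apply/asboolP; exists w.
exists (fun v => ex_minn (exP v)) => v; case: ex_minnP => m /asboolP[w [vw wi sw]] mmin.
split.
  have /connectP[w' vw' w'i] := conn v.
  case/shortenP: vw' w'i => w'' vw'' uw'' _ w''i.
  apply: (@leq_ltn_trans (size w'')).
    by apply: mmin; apply/asboolP; exists w''; split.
  have := card_uniqP uw'' => /= <-; exact: max_card.
case: w vw wi sw => [_ /= -> _|j w /= /andP[vj jw] wi <- _]; first by rewrite eqxx.
exists j; split => //; case: ex_minnP => n _ nmin; rewrite ltnS; apply: nmin.
by apply/asboolP; exists w.
Qed.

(** A path that starts at distance [d v] from [i0] can descend to [i0], where the number
of continuations doubles, and each return takes at most [#|I|] steps.  The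
exponent is arranged so that a descending step leaves it unchanged and a step
from [i0] increases it by one. *)
Lemma card_paths_ge (I : finType) (e : rel I) (i0 : I) (j : bool -> I) (n : nat) :
  (forall i, connect e i i0) -> injective j -> (forall b, e i0 (j b)) ->
  (2 ^ ((n + #|I|.-1) %/ #|I|) <= \sum_(w : n.-tuple I) path e i0 w)%N.
Proof.
move=> conn jinj i0j; have [d dP] := exists_descent conn.
have I0 : (0 < #|I|)%N by apply/card_gt0P; exists i0.
suff H v : (2 ^ ((n + (#|I|.-1 - (if v == i0 then 0 else d v))) %/ #|I|) <=
    \sum_(w : n.-tuple I) path e v w)%N.
  by have := H i0; rewrite eqxx subn0.
elim: n v => [|n IHn] v.
  rewrite (sum_tuple0 (fun w => path e v w : nat)) divn_small // add0n.
  by rewrite (leq_ltn_trans (leq_subr _ _)) // prednK.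
rewrite (sum_tuple_cons _ (fun w => path e v w : nat)) /=.
pose c i := (\sum_(w : n.-tuple I) path e i w)%N.
have cE i : e v i -> (\sum_(w : n.-tuple I) (e v i && path e i w))%N = c i.
  by move=> ->.
have [->|vi0] := eqVneq v i0.
  have cj b : (2 ^ (n %/ #|I|) <= c (j b))%N.
    by apply: leq_trans (IHn _); rewrite leq_exp2l // leq_div2r // leq_addr.
  have jTF : j false != j true by apply/eqP => /jinj.
  rewrite (bigD1 (j true)) //= (bigD1 (j false)) //= !i0j /= addnA.
  rewrite subn0 addSnnS prednK // divnDr ?dvdnn // divnn I0 addn1 expnS mul2n -addnn.
  by apply: leq_trans (leq_addr _ _); apply: leq_add; exact: cj.
have [_ /(_ vi0)[i [vi di]]] := dP v.
rewrite (bigD1 i) //= cE //; apply: leq_trans (leq_addr _ _).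
apply: leq_trans (IHn i); rewrite leq_exp2l // leq_div2r // addSn -addnS leq_add2l.
have [dv _] := dP v; case: ifP => _; move: dv di I0;
  by move: (d v) (d i) (#|I|) => x y z; lia.
Qed.

(** Fekete's lemma; the limit is the infimum of the quotients [a n / n]. *)
Lemma fekete_subadditive (R : realType) (a : nat -> R) :
  (forall n, 0 <= a n) -> (forall n m, a (n + m)%N <= a n + a m) ->
  cvgn (fun n => a n / n%:R).
Proof.
move=> a0 asub.
have amul q m : a (q * m)%N <= a 0%N + q%:R * a m.
  elim: q => [|q IHq]; first by rewrite mul0n mul0r addr0.
  by rewrite mulSn (le_trans (asub _ _)) // mulrSr; lra.
pose S := [set a n / n%:R | n in [set n | (0 < n)%N]].
have infS : has_inf S.
  split; first by exists (a 1%N / 1); exists 1%N.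
  by exists 0 => _ [n _ <-]; rewrite divr_ge0.
apply/cvg_ex; exists (inf S); apply/cvgrPdist_le => eps eps0.
have [_ [m /= m0 <-] am] := inf_adherent (divr_gt0 eps0 (ltr0n R 2)) infS.
(* Bounds the contribution of the remainder of n modulo m. *)
pose C := a 0%N + \sum_(r < m) a r.
near=> n.
have n0 : (0 < n)%N by near: n; exact: nbhs_infty_gt.
have infn : inf S <= a n / n%:R by apply: ge_inf; [case: infS|exists n].
rewrite distrC ger0_norm ?subr_ge0 // lerBlDr ler_pdivrMr ?ltr0n //.
have Cn : C / (eps / 2) <= n%:R by near: n; exact: nbhs_infty_ger.
rewrite ler_pdivrMr ?divr_gt0 // in Cn.
have an : a n <= C + n%:R * (a m / m%:R).
  have q0 : (n %/ m * m <= n)%N by exact: leq_trunc_div.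
  rewrite {1}(divn_eq n m) (le_trans (asub _ _)) // /C.
  have am_r : a (n %% m)%N <= \sum_(r < m) a r.
    rewrite (bigD1 (Ordinal (ltn_pmod n m0))) //= lerDl; exact: sumr_ge0.
  have qn : (n %/ m)%:R * a m <= n%:R * (a m / m%:R).
    rewrite mulrA ler_pdivlMr ?ltr0n // mulrAC -natrM ler_wpM2r // ler_nat //.
  by have := amul (n %/ m)%N m; lra.
have := ler_wpM2l (ler0n R n) (ltW am); lra.
Unshelve. all: by end_near.
Qed.

(** Enumerations may repeat elements, which makes products of subcovers and
counting easier than with exact cardinalities; the least such [k] is the same. *)
Definition covered_by (X : Type) (U : set (set X)) (k : nat) : Prop :=
  exists g : nat -> set X, (forall i, (i < k)%N -> U (g i)) /\
    forall x, exists2 i, (i < k)%N & g i x.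

(** The induction peels off the first set, hence the shift [m] of the times in
the generalised claim. *)
Lemma iterated_joinP (X : Type) (T : X -> X) (U : set (set X)) (n : nat) (B : set X) :
  iterated_join T U n B <->
  exists g : nat -> set X, (forall k, (k < n)%N -> U (g k)) /\
    B = [set x | forall k, (k < n)%N -> g k (iter k T x)].
Proof.
rewrite /iterated_join.
suff H m : (\big[@cover_join X/[set [set: X]]]_(k < n)
      (preimage (iter (m + k) T) @` U)) B <->
    exists g : nat -> set X, (forall k, (k < n)%N -> U (g k)) /\
    B = [set x | forall k, (k < n)%N -> g k (iter (m + k) T x)].
  exact: (H 0%N).
elim: n m B => [|n IHn] m B.
  rewrite big_ord0; split=> [->|[g [_ ->]]]; last by apply/seteqP; split.
  by exists (fun=> setT); split => //; apply/seteqP; split.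
rewrite big_ord_recl /=.
have -> : (\big[@cover_join X/[set [set: X]]]_(i < n)
      (preimage (iter (m + bump 0 i) T) @` U)) =
    (\big[@cover_join X/[set [set: X]]]_(k < n) (preimage (iter (m.+1 + k) T) @` U)).
  by apply: eq_bigr => i _; rewrite /bump /= add1n (addSnnS m i).
split=> [[_ [B0 UB0 <-] [B1 /IHn[g [gU ->]] <-]]|[g [gU ->]]].
  exists (fun k => if k is k'.+1 then g k' else B0); split => [[|k]//|].
    exact: gU.
  apply/seteqP; split=> [x [Bx gx] [_|k kn]|x gx] //.
    by have := gx k kn; rewrite addSnnS.
  split; first exact: (gx 0%N).
  by move=> k kn; have := gx k.+1 kn; rewrite addSnnS.
exists (iter (m + 0) T @^-1` g 0%N); first by exists (g 0%N) => //; exact: gU.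
exists [set x | forall k, (k < n)%N -> g k.+1 (iter (m.+1 + k) T x)].
  by apply/IHn; exists (g \o succn); split => // k kn; exact: gU.
apply/seteqP; split=> [x [g0 gx] [//|k] kn|x gx]; first by rewrite -addSnnS; exact: gx.
split; first exact: gx.
by move=> k kn; have := gx k.+1 kn; rewrite -addSnnS.
Qed.

Lemma covered_by_card (X : Type) (U V : set (set X)) (k : nat) :
  V `<=` U -> cover V id = [set: X] -> (V #= `I_k)%card -> covered_by U k.
Proof.
move=> VU VX; rewrite card_eq_sym => /card_set_bijP[g [gV ginj gsurj]].
exists g; split => [i ik|x]; first by apply/VU/gV.
have [B VB Bx] : cover V id x by rewrite VX.
by have [i ik gi] := gsurj _ VB; exists i => //; rewrite gi.
Qed.

Lemma exists_card_subcover (X : Type) (U : set (set X)) (k : nat) :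
  covered_by U k ->
  exists2 m, (m <= k)%N & exists V : set (set X),
    [/\ V `<=` U, cover V id = [set: X] & (V #= `I_m)%card].
Proof.
move=> [g [gU gX]].
have /finite_setP[m Vm] : finite_set (g @` `I_k) by apply: finite_image; exact: finite_II.
exists m.
  by rewrite -card_le_II -(card_le_eql Vm) card_image_le.
exists (g @` `I_k); split => //.
  by move=> _ [i ik <-]; exact: gU.
apply/seteqP; split => // x _; have [i ik gix] := gX x.
by exists (g i) => //; exists i.
Qed.

Lemma covering_numberP (R : realType) (X : Type) (U : set (set X)) (k : nat) :
  covered_by U k ->
  exists m, [/\ covering_number R U = m%:R, covered_by U m &
    forall k', covered_by U k' -> (m <= k')%N].
Proof.
move=> Uk.
have exU : exists k, `[< covered_by U k >] by exists k; apply/asboolP.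
have [m /asboolP Um mmin] := ex_minnP exU.
have mmin' k' : covered_by U k' -> (m <= k')%N by move=> ?; apply/mmin/asboolP.
exists m; split => //.
have [m' m'm [V [VU VX Vm']]] := exists_card_subcover Um.
have mm' : m' = m.
  by apply/eqP; rewrite eqn_leq m'm; apply: mmin'; exact: covered_by_card Vm'.
rewrite mm' in Vm'; apply/eqP; rewrite eq_le; apply/andP; split.
  apply: ge_inf; last by exists m => //; exists V.
  by exists 0 => _ [k' _ <-].
apply: lb_le_inf; first by exists m%:R; exists m => //; exists V.
move=> _ [k' [V' [V'U V'X V'k]] <-]; rewrite ler_nat; apply: mmin'.
exact: covered_by_card V'k.
Qed.

Lemma covered_by_join_add (X : Type) (T : X -> X) (U : set (set X)) (n m a b : nat) :
  covered_by (iterated_join T U n) a -> covered_by (iterated_join T U m) b ->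
  covered_by (iterated_join T U (n + m)) (a * b).
Proof.
move=> [g [gJ gX]] [g' [g'J g'X]].
(* Pairs of indices are coded by quotient and remainder modulo b. *)
exists (fun i => g (i %/ b)%N `&` iter n T @^-1` g' (i %% b)%N); split.
  move=> i iab.
  have b0 : (0 < b)%N by case: b iab {g'J g'X} => //; rewrite muln0.
  have /iterated_joinP[h [hU ->]] := gJ (i %/ b)%N ltac:(by rewrite ltn_divLR).
  have /iterated_joinP[h' [h'U ->]] := g'J (i %% b)%N (ltn_pmod _ b0).
  apply/iterated_joinP.
  exists (fun k => if (k < n)%N then h k else h' (k - n)%N); split.
    move=> k kn; case: ltnP => nk; first exact: hU.
    by apply: h'U; rewrite ltn_subLR.
  apply/seteqP; split=> [x [/= hx h'x] k kn|x /= hx].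
    case: ltnP => nk; first exact: hx.
    have := h'x (k - n)%N; rewrite -iterD subnK //; apply; by rewrite ltn_subLR.
  split=> [k kn|k km].
    by have := hx k (ltn_addr _ kn); rewrite kn.
  by have := hx (n + k)%N; rewrite ltn_add2l km ltnNge leq_addr /= addKn -iterD addnC; apply.
move=> x; have [i ia gx] := gX x; have [i' ib gx'] := g'X (iter n T x).
have b0 : (0 < b)%N by exact: leq_ltn_trans ib.
exists (i * b + i')%N.
  by apply: (@leq_trans (i.+1 * b)); rewrite ?leq_mul2r ?ia ?orbT // mulSn addnC ltn_add2r.
by split; rewrite /= ?modnMDl ?modn_small // divnMDl // divn_small // addn0.
Qed.

Lemma covered_by_join (X : Type) (T : X -> X) (U : set (set X)) (k n : nat) :
  covered_by U k -> covered_by (iterated_join T U n) (k ^ n).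
Proof.
move=> [g [gU gX]]; elim: n => [|n IHn].
  exists (fun=> setT); split; last by move=> x; exists 0%N.
  by move=> i _; apply/iterated_joinP; exists (fun=> setT); split => //; apply/seteqP; split.
rewrite -addn1 expnD; apply: covered_by_join_add => //; rewrite expn1.
exists g; split => // i ik; apply/iterated_joinP; exists (fun=> g i).
split; first by move=> *; exact: gU.
by apply/seteqP; split=> [x gx [|//]|x /(_ 0%N)/=]; last exact.
Qed.

(** Subadditivity turns the bounds at multiples of [p] into a bound at every
[n]: [n * ln 2 <= a (p * n) <= p * a n], where [a n] is the logarithm of the
covering number. *)
Lemma cover_entropy_ge (R : realType) (X : Type) (T : X -> X) (U : set (set X))
    (k p : nat) (x0 : X) :
  covered_by U k -> (0 < p)%N ->
  (forall q m, covered_by (iterated_join T U (p * q)) m -> (2 ^ q <= m)%N) ->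
  ln 2 / p%:R <= cover_entropy R T U.
Proof.
move=> Uk p0 Uge.
have /choice[N NP] : forall n, exists m, [/\ covering_number R (iterated_join T U n) = m%:R,
  covered_by (iterated_join T U n) m & forall k', covered_by (iterated_join T U n) k' -> (m <= k')%N].
  by move=> n; exact: covering_numberP (covered_by_join T n Uk).
pose a n : R := ln (N n)%:R.
have N0 n : (0 < N n)%N.
  by have [_ [g [_ /(_ x0)[i iN _]]] _] := NP n; exact: leq_ltn_trans iN.
have Nsub n m : (N (n + m) <= N n * N m)%N.
  by have [_ _] := NP (n + m)%N; apply; apply: covered_by_join_add; [case: (NP n)|case: (NP m)].
have a0 n : 0 <= a n by rewrite ln_ge0 // ler1n.
have asub n m : a (n + m)%N <= a n + a m.
  rewrite /a -lnM ?posrE ?ltr0n // -natrM ler_ln ?posrE ?ltr0n ?muln_gt0 ?N0 //.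
  by rewrite ler_nat.
rewrite /cover_entropy (_ : (fun n => _) = fun n => a n / n%:R); last first.
  by apply/funext => n; rewrite /a; have [->] := NP n.
apply: limr_ge; first exact: fekete_subadditive.
near=> n.
have n0 : (0 < n)%N by near: n; exact: nbhs_infty_gt.
rewrite ler_pdivrMr ?ltr0n // mulrAC ler_pdivlMr ?ltr0n // mulrC.
have apn : n%:R * ln 2 <= a (p * n)%N.
  have [_ Npn _] := NP (p * n)%N.
  rewrite mulr_natl -lnXn ?ltr0n // ler_ln ?posrE ?exprn_gt0 ?ltr0n // -natrX ler_nat.
  exact: Uge Npn.
have amul q m : a (q.+1 * m)%N <= q.+1%:R * a m.
  elim: q => [|q IHq]; first by rewrite mul1n mul1r.
  by rewrite mulSn (le_trans (asub _ _)) // [in leRHS]mulrSr; lra.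
rewrite (le_trans apn) //; move: (amul p.-1 n); rewrite prednK // => /le_trans; apply.
by rewrite mulrC.
Unshelve. all: by end_near.
Qed.

(** An element of the join that contains a point with itinerary [v :: w] is given
by a sequence of sets [U i], and this sequence must be the itinerary. *)
Lemma card_paths_le_cover (R : realType) (X : metricType R) (T : X -> X) (p : nat)
    (A : 'M[nat]_p) (L : 'I_p -> set X) (U : 'I_p -> set X) (v : 'I_p) (n k : nat) :
  coupled_expanding T A L -> (forall i j, i != j -> U i `&` L j = set0) ->
  covered_by (iterated_join T (range U) n.+1) k ->
  (\sum_(w : n.-tuple 'I_p) path (transition A) v w <= k)%N.
Proof.
move=> hL UL [g [gJ gX]]; have [L0 _ _] := hL.
have /choice[x xP] : forall w : n.-tuple 'I_p, exists x, path (transition A) v w ->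
    forall i, (i <= n)%N -> L (nth v (v :: w) i) (iter i T x).
  move=> w; have [y Ly] := L0 (last v w); have [vw|] := boolP (path (transition A) v w).
    have [x [_ xP]] := exists_itinerary hL vw Ly; rewrite size_tuple in xP.
    by exists x.
  by exists y.
have /choice[i iP] : forall w, exists i : 'I_k, g i (x w).
  by move=> w; have [i ik gi] := gX (x w); exists (Ordinal ik).
rewrite -big_mkcond sum1_card -[leqRHS]card_ord.
rewrite -(card_in_imset (f := i)) ?max_card //.
move=> w w'; rewrite !unfold_in => vw vw' ii'; apply/val_inj.
have /iterated_joinP[h [hU gE]] := gJ _ (ltn_ord (i w)).
apply: (@eq_from_nth _ v) => [|l]; rewrite !size_tuple // => ln.
have := iP w'; rewrite -ii' gE => /(_ l.+1 ln) hw'.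
have := iP w; rewrite gE => /(_ l.+1 ln) hw.
have [m _ hm] := hU l.+1 ln.
have mE (u : n.-tuple 'I_p) : path (transition A) v u -> h l.+1 (iter l.+1 T (x u)) ->
    m = nth v u l.
  move=> vu hu; apply/eqP; apply: contrapT => /negP /UL.
  move/seteqP => [sub _]; apply: (sub (iter l.+1 T (x u))); rewrite hm.
  by split => //; exact: (xP u vu l.+1).
by rewrite -(mE w vw hw) -(mE w' vw' hw').
Qed.

Lemma coupled_expanding_entropy (R : realType) (X : metricType R) (T : X -> X) (p : nat)
    (A : 'M[nat]_p) (L : 'I_p -> set X) :
  (2 <= p)%N -> transition_matrix A -> irreducible_mx A ->
  (exists i0 : 'I_p, (2 <= \sum_(j < p) A i0 j)%N) ->
  strictly_coupled_expanding T A L ->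
  ((ln (2 : R) / p%:R)%:E <= topological_entropy T)%E.
Proof.
move=> p2 hA irrA [i0 /(branching_row hA)[j [jinj i0j]]] [hL dL].
have [L0 _ _] := hL; have [x0 _] := L0 i0.
have conn := irreducible_connect hA irrA.
pose U i := ~` closure (\bigcup_(l in [set l | l != i]) L l).
have Uopen i : open (U i) by apply: closed_openC; exact: closed_closure.
have UL i l : i != l -> U i `&` L l = set0.
  move=> il; apply/seteqP; split=> // x [nx Lx]; apply: nx; apply: subset_closure.
  by exists l => //=; rewrite eq_sym.
have [e e0 eL] : exists2 e, 0 < e & forall i l, i != l -> e <= set_dist (L i) (L l).
  exists (\big[Num.min/1]_(u : 'I_p * 'I_p | u.1 != u.2) set_dist (L u.1) (L u.2)).
    by apply: Order.POrderTheory.lt_bigmin => // u; exact: dL.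
  by move=> i l il; apply: (bigmin_le_cond _ (j := (i, l))).
have e2 : 0 < e / 2 by rewrite divr_gt0.
(* A ball of radius e / 2 meets at most one of the sets L i. *)
have UX x : exists i, U i x.
  have [[i [y [xy Ly]]]|noL] := pselect (exists i, ball x (e / 2) `&` L i !=set0).
    exists i => /(_ _ (nbhsx_ballx x _ e2))[z [[l li Lz] xz]].
    have := set_dist_le_closure (subset_closure Lz) (subset_closure Ly).
    have := metric_triangle z x y; have := eL l i li.
    by move: xy xz; rewrite !ballEmdist /= (metric_sym z x); lra.
  exists i0 => /(_ _ (nbhsx_ballx x _ e2))[z [[l li Lz] xz]].
  by apply: noL; exists l, z.
have Ucov : covered_by (range U) p.
  exists (fun k => U (insubd i0 k)); split; first by move=> k _; exists (insubd i0 k).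
  by move=> x; have [i Ui] := UX x; exists i => //; rewrite valKd.
apply: (@le_trans _ _ (cover_entropy R T (range U))%:E).
  rewrite lee_fin; apply: (cover_entropy_ge _ x0 Ucov); first exact: ltnW.
  move=> q m; case: q => [|q] cov.
    by have [g [_ /(_ x0)[i im _]]] := cov; rewrite expn0 (leq_ltn_trans _ im).
  have pq : (p * q.+1 = (p * q.+1).-1.+1)%N by rewrite prednK // muln_gt0 (ltnW p2).
  rewrite pq in cov; apply: leq_trans (card_paths_le_cover i0 hL UL cov).
  apply: leq_trans (card_paths_ge _ (conn^~ i0) jinj i0j).
  rewrite leq_exp2l // card_ord leq_divRL ?(ltnW p2) //.
  by move: pq; set r := (p * q.+1)%N; rewrite (mulnC q.+1) -/r; lia.
apply: ereal_sup_ubound; exists (range U) => //; split.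
  by apply: finite_image; exact: finite_finset.
split; first by move=> _ [i _ <-].
apply/seteqP; split => // x _; have [i Ui] := UX x.
by exists (U i) => //; exists i.
Qed.

(** * Conclusion *)

Theorem theorem2 (R : realType) (X : metricType R) (T : X -> X)
  (p : nat) (A : 'M[nat]_p) (L : 'I_p -> set X)
  (hT : dynamical_system T)
  (hp : (2 <= p)%N)
  (hA : transition_matrix A)
  (hirr : irreducible_mx A)
  (hrow : exists i0 : 'I_p, (2 <= \sum_(j < p) A i0 j)%N)
  (hL : strictly_coupled_expanding T A L) :
  ((ln (2 : R) / p%:R)%:E <= topological_entropy T)%E /\ li_yorke_chaotic T.
Proof.
split; first exact: coupled_expanding_entropy hp hA hirr hrow hL.
have [cX cT _] := hT; have [hexp dL] := hL.
have [i0 /(branching_row hA)[j [jinj i0j]]] := hrow.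
apply: (rich_pair_li_yorke (D := fun b => closure (L (j b)))
  (d := set_dist (L (j false)) (L (j true)))) => //.
- by move=> b; exact: closed_closure.
- exact: rich_branches hexp (irreducible_connect hA hirr) i0j.
- by apply: dL; apply/eqP => /jinj.
- by move=> x y; exact: set_dist_le_closure.
Qed.
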